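(* Let $T\ge 2$, $n\ge 2$ and $k\ge 1$ be integers with $k\le n/2$. Let $V_n$ be the value of the periodic patrolling game on the line graph $L_n$ with period $T$ and attack duration $2$ with a single Patroller, and let $V_n^{(k)}$ be the value of the corresponding $k$ Patroller game on $L_n$. Then $$V_n^{(k)}=k\,V_n.$$
   Context: The line graph $L_n$ is the graph with node set $\{1,2,\dots,n\}$ and edges $\{i,i+1\}$ for $i=1,\dots,n-1$ (the path on $n$ nodes). The periodic patrolling game on a graph $Q$ with node set $N$, period $T$ and attack duration $2$ is the following finite zero-sum game. Times form the time circle $\{1,2,\dots,T\}$ with arithmetic modulo $T$. A pure strategy of the Patroller (a patrol) is a walk $w:\{1,2,\ldots\}\to N$ such that $w(t)$ and $w(t+1)$ are the same or adjacent nodes and $w(t+T)=w(t)$ for all $t$. A pure strategy of the Attacker is a pair consisting of a node $i\in N$ and an attack interval $J=\{t,t+1\}$ of two consecutive times (modulo $T$). The patrol $w$ intercepts the attack if $w(s)=i$ for some $s\in J$; the payoff (to the Patroller, who maximizes; the Attacker minimizes) is $1$ if the attack is intercepted and $0$ otherwise. Both players may use mixed strategies; the value is the expected payoff under optimal play. In the $k$ Patroller game the Attacker's strategy set is the same, but a pure strategy of his opponent is a choice of $k$ patrols (each a walk $w:\{1,2,\ldots\}\to N$ such that $w(t)$ and $w(t+1)$ are the same or adjacent nodes and $w(t+T)=w(t)$ for all $t$), and mixed strategies may correlate the $k$ patrols. The payoff is $1$ if at least one of the $k$ patrols intercepts the attack, and $0$ otherwise. *)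

(* Defs.v *)
From mathcomp Require Import all_boot all_order all_algebra.
From mathcomp Require Import reals.

Set Implicit Arguments.
Unset Strict Implicit.
Unset Printing Implicit Defensive.

Import Order.TTheory GRing.Theory Num.Theory.
Local Open Scope ring_scope.

(* Finite zero-sum games given by the payoff function [A : S -> S' -> R] to the
   maximizer, whose pure strategies form [S]; the minimizer's form [S']. *)

Definition mixed (R : realType) (S : finType) (p : {ffun S -> R}) : Prop :=
  (forall s, 0 <= p s) /\ \sum_s p s = 1.

Definition expected_payoff (R : realType) (S S' : finType) (A : S -> S' -> R)
    (p : {ffun S -> R}) (q : {ffun S' -> R}) : R :=
  \sum_s \sum_a p s * q a * A s a.

(* [p] and [q] are optimal mixed strategies: [p] guarantees at least [v] and
   [q] concedes at most [v].  Such a [v] is unique, see [is_value_unique]. *)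
Definition is_value (R : realType) (S S' : finType) (A : S -> S' -> R)
    (v : R) : Prop :=
  exists (p : {ffun S -> R}) (q : {ffun S' -> R}),
    [/\ mixed p, mixed q,
        forall q', mixed q' -> v <= expected_payoff A p q'
      & forall p', mixed p' -> expected_payoff A p' q <= v].

Lemma is_value_unique (R : realType) (S S' : finType) (A : S -> S' -> R)
    (v v' : R) : is_value A v -> is_value A v' -> v = v'.
Proof.
move=> [p [q [mp mq lo up]]] [p' [q' [mp' mq' lo' up']]].
apply/le_anti/andP; split.
  exact: le_trans (lo _ mq') (up' _ mp).
exact: le_trans (lo' _ mq) (up _ mp').
Qed.

(* The node [i] of the path on [{1, ..., n}] is the ordinal [i - 1]. *)
Definition line_adj (n : nat) : rel 'I_n :=
  fun i j => (i.+1 == j :> nat) || (j.+1 == i :> nat).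

(* A [T]-periodic walk is determined by its restriction to the time circle,
   represented by ['I_T]; [ordS] is the cyclic successor, so the last time is
   followed by the first one. *)
Definition is_patrol (T : nat) (N : finType) (adj : rel N)
    (w : {ffun 'I_T -> N}) : bool :=
  [forall t, (w t == w (ordS t)) || adj (w t) (w (ordS t))].

Definition patrol (T : nat) (N : finType) (adj : rel N) : finType :=
  {w : {ffun 'I_T -> N} | is_patrol adj w}.

(* [(i, t)] is the attack at node [i] during the interval [{t, t + 1}].  (For
   [T = 2] the two starting times give the same interval; duplicating a pure
   strategy does not affect the value.) *)
Definition attack (T : nat) (N : finType) : finType := (N * 'I_T)%type.

Definition intercepts (T : nat) (N : finType) (adj : rel N)
    (w : patrol T adj) (a : attack T N) : bool :=
  (val w a.2 == a.1) || (val w (ordS a.2) == a.1).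

Definition patrolling_payoff (R : realType) (T : nat) (N : finType)
    (adj : rel N) (w : patrol T adj) (a : attack T N) : R :=
  (intercepts w a)%:R.

(* A pure strategy is a [k]-tuple of patrols, so that a mixed strategy may
   correlate them. *)
Definition multi_patrolling_payoff (R : realType) (T : nat) (N : finType)
    (adj : rel N) (k : nat) (W : {ffun 'I_k -> patrol T adj})
    (a : attack T N) : R :=
  [exists j, intercepts (W j) a]%:R.

(* Main.v *)
(* Number the nodes 0, ..., n - 1.  The Patroller draws a random matching made of
   M = n./2 edges: the perfect matching {2e, 2e + 1} if n is even, and the
   matching missing a uniformly chosen even node if n is odd.  The M edges are
   shifted cyclically at random, and the j-th patrol oscillates, with a random
   phase, on the j-th edge.  Patrols on different edges never intercept the same
   attack, so k of them intercept an attack with exactly k times the probability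
   of one, for every k <= M; conversely k patrols intercept at most k times what
   one does.  It remains to see that a single such patrol is optimal.

   If T is odd, an oscillation misses one attack at one end of its edge; let p be
   the probability that the missed attack is at the odd node.  The bounds are met
   by the Attacker as follows, with d = 1 if T is odd and d = 0 otherwise.
   - n even, p = 1/2: uniform attack, value (2T - d) / (nT);
   - n odd and (T even or M < T), p = 1: simultaneous attacks at a uniform even
     node, value 1 / (M + 1);
   - n odd, T odd and T <= M, p = (T + M) / n, which equalizes the interception
     probabilities of even and odd nodes: uniform attack, value
     (2T - 1) / (nT). *)

Require Import Defs.
From mathcomp Require Import all_boot all_order all_algebra.
From mathcomp Require Import reals.
From mathcomp Require Import zify ring lra.

Import Order.TTheory GRing.Theory Num.Theory.
Local Open Scope ring_scope.

(** * Mixed strategies given by sampling *)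

Lemma sum_pushforward {R : realType} {S I : finType} (F : I -> S)
    (mu : I -> R) (f : S -> R) :
  \sum_s (\sum_(i | F i == s) mu i) * f s = \sum_i mu i * f (F i).
Proof.
rewrite (partition_big F xpredT) //=; apply: eq_bigr => s _.
by rewrite mulr_suml; apply: eq_bigr => i /eqP ->.
Qed.

Lemma mixed_pushforward {R : realType} {S I : finType} (F : I -> S)
    (mu : I -> R) :
  (forall i, 0 <= mu i) -> \sum_i mu i = 1 ->
  mixed [ffun s => \sum_(i | F i == s) mu i].
Proof.
move=> mu0 mu1; split=> [s|]; first by rewrite ffunE sumr_ge0.
rewrite (partition_big F xpredT) //= in mu1; rewrite -mu1.
by apply: eq_bigr => s _; rewrite ffunE.
Qed.

(** Mixed strategies are pushforwards of weights on sample spaces. Since the expected payoff is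
    bilinear, it suffices to test each one against pure strategies. *)
Lemma is_value_sampled {R : realType} {S S' I I' : finType} (A : S -> S' -> R)
    (v : R) (mu : I -> R) (nu : I' -> R) (F : I -> S) (G : I' -> S') :
  (forall i, 0 <= mu i) -> \sum_i mu i = 1 ->
  (forall i, 0 <= nu i) -> \sum_i nu i = 1 ->
  (forall a, v <= \sum_i mu i * A (F i) a) ->
  (forall s, \sum_i nu i * A s (G i) <= v) ->
  is_value A v.
Proof.
move=> mu0 mu1 nu0 nu1 lo up.
exists [ffun s => \sum_(i | F i == s) mu i].
exists [ffun s => \sum_(i | G i == s) nu i].
split; try exact: mixed_pushforward.
- move=> q [q0 q1]; rewrite /expected_payoff exchange_big /=.
  rewrite -[v]mulr1 -q1 mulr_sumr; apply: ler_sum => a _.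
  under eq_bigr do rewrite ffunE -mulrA.
  rewrite (sum_pushforward F mu (fun s => q a * A s a)) mulrC.
  apply: le_trans (ler_wpM2l (q0 a) (lo a)) _.
  by rewrite mulr_sumr; apply: ler_sum => i _; rewrite mulrCA.
- move=> q [q0 q1]; rewrite /expected_payoff.
  rewrite -[v]mulr1 -q1 mulr_sumr; apply: ler_sum => s _.
  under eq_bigr do rewrite ffunE [q s * _]mulrC -mulrA.
  rewrite (sum_pushforward G nu (fun a => q s * A s a)) [v * _]mulrC.
  apply: le_trans (ler_wpM2l (q0 s) (up s)).
  by rewrite mulr_sumr; apply: ler_sum => i _; rewrite mulrCA.
Qed.

(** * From one patrol to [k] disjoint patrols *)

Section DisjointPatrols.
Context {R : realType} {T : nat} {N : finType} {adj : rel N} {m : nat}.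
Context {I I' : finType} (mu : I -> R) (nu : I' -> R).
Context (F : I -> 'I_m -> patrol T adj) (G : I' -> attack T N) (v : R).
Hypothesis mu0 : forall i, 0 <= mu i.
Hypothesis mu1 : \sum_i mu i = 1.
Hypothesis nu0 : forall i, 0 <= nu i.
Hypothesis nu1 : \sum_i nu i = 1.
Hypothesis disj : forall i a e e',
  intercepts (F i e) a -> intercepts (F i e') a -> e = e'.
Hypothesis lo : forall e a, v <= \sum_i mu i * patrolling_payoff R (F i e) a.
Hypothesis up : forall w : patrol T adj, \sum_i nu i * patrolling_payoff R w (G i) <= v.

Lemma multi_payoff_le k (W : {ffun 'I_k -> patrol T adj}) a :
  multi_patrolling_payoff R W a <= \sum_j patrolling_payoff R (W j) a.
Proof.
rewrite /multi_patrolling_payoff /patrolling_payoff.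
case: existsP => [[j Wj]|_]; last exact: sumr_ge0.
by rewrite (bigD1 j) //= Wj lerDl sumr_ge0.
Qed.

(** By [disj] the interceptions by different patrols of one sample are exclusive, so their
    probabilities add up. For arbitrary patrols the sum is still an upper bound, so the Attacker
    keeps the same [nu]. *)
Lemma disjoint_patrols_value (k : nat) : (1 <= k <= m)%N ->
  is_value (@patrolling_payoff R T N adj) v /\
  is_value (@multi_patrolling_payoff R T N adj k) (k%:R * v).
Proof.
move=> /andP[k_gt0 le_km]; split.
  have e : 'I_m by exists 0%N; apply: leq_trans le_km.
  by apply: (is_value_sampled _ _ mu nu (F^~ e) G).
have sum_v : \sum_(j < k) v = k%:R * v by rewrite sumr_const card_ord mulr_natl.
pose W i : {ffun 'I_k -> patrol T adj} := [ffun j => F i (widen_ord le_km j)].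
apply: (is_value_sampled _ _ mu nu W G) => // [a|w].
  have -> : \sum_i mu i * multi_patrolling_payoff R (W i) a =
      \sum_(j < k) \sum_i mu i * patrolling_payoff R (F i (widen_ord le_km j)) a.
    rewrite exchange_big; apply: eq_bigr => i _; rewrite -mulr_sumr.
    congr (_ * _); rewrite /multi_patrolling_payoff /patrolling_payoff.
    case: existsP => [[j]|noj].
      rewrite ffunE => ij; rewrite (bigD1 j) //= ij big1 ?addr0 // => j' neq_j.
      apply/eqP; rewrite pnatr_eq0 eqb0; apply: contra neq_j => /disj/(_ ij) jj.
      by apply/eqP/val_inj; case: jj.
    rewrite big1 // => j _; apply/eqP; rewrite pnatr_eq0 eqb0.
    by apply/negP => ij; apply: noj; exists j; rewrite ffunE.
  by rewrite -sum_v; apply: ler_sum.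
apply: (@le_trans _ _ (\sum_(j < k) \sum_i nu i * patrolling_payoff R (w j) (G i))).
  rewrite exchange_big; apply: ler_sum => i _; rewrite -mulr_sumr.
  by apply: ler_wpM2l => //; apply: multi_payoff_le.
by rewrite -sum_v; apply: ler_sum.
Qed.

End DisjointPatrols.

(** * Oscillation on an edge *)

Lemma oscillation_subproof {T : nat} {N : finType} {adj : rel N} {s w : N}
    (t : 'I_T.+1) : adj s w -> adj w s ->
  is_patrol adj [ffun u : 'I_T.+1 => if odd (u + t)%R then w else s].
Proof.
move=> asw aws; apply/forallP => u; rewrite !ffunE.
by do 2 case: ifP; rewrite ?eqxx ?asw ?aws ?orbT.
Qed.

(** If the period [T.+1] is odd, the phases [T] and [0] are cyclically consecutive and both even:
    the patrol then rests at [s], and [w] misses one attack. The end [s] is protected for every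
    period. *)
Definition oscillation {T : nat} {N : finType} {adj : rel N} {s w : N}
    (asw : adj s w) (aws : adj w s) (t : 'I_T.+1) : patrol T.+1 adj :=
  exist (fun w => is_patrol adj w) _ (oscillation_subproof t asw aws).

Lemma oscillationE {T : nat} {N : finType} {adj : rel N} {s w : N}
    (asw : adj s w) (aws : adj w s) (t u : 'I_T.+1) :
  val (oscillation asw aws t) u = if odd (u + t)%R then w else s.
Proof. by rewrite ffunE. Qed.

Lemma oscillation_node {T : nat} {N : finType} {adj : rel N} {s w : N}
    (asw : adj s w) (aws : adj w s) (t : 'I_T.+1) (a : attack T.+1 N) :
  intercepts (oscillation asw aws t) a -> (a.1 == s) || (a.1 == w).
Proof.
rewrite /intercepts !oscillationE !(eq_sym a.1).
by do 2 case: ifP => _; do 2 case: (_ == a.1).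
Qed.

Lemma even_or_even_ordS {T : nat} (z : 'I_T.+1) : ~~ odd z || ~~ odd (ordS z).
Proof.
rewrite /= -negb_and; case: (ltngtP z.+1 T.+1) (ltn_ord z) => // [lt_z|->] _.
  by rewrite modn_small //=; case: (odd z).
by rewrite modnn andbF.
Qed.

(** The only possible failure is the wrap-around [z = T], whose successor is 0; it fails when [T] is
    even. *)
Lemma sum_odd_or_odd_ordS (T : nat) :
  (\sum_(z < T.+1) (odd z || odd (ordS z)) = T.+1 - odd T.+1)%N.
Proof.
rewrite big_ord_recr /= modnn orbF (eq_bigr (fun=> 1%N)) => [|i _].
  by rewrite sum_nat_const card_ord muln1; case: (odd T); rewrite /= ?addn1; lia.
by rewrite modn_small ?ltnS //=; case: (odd i).
Qed.

Lemma oscillation_interceptions {T : nat} {N : finType} {adj : rel N} {s w : N}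
    (asw : adj s w) (aws : adj w s) (a : attack T.+1 N) : s != w ->
  (\sum_t intercepts (oscillation asw aws t) a =
   (a.1 == s) * T.+1 + (a.1 == w) * (T.+1 - odd T.+1))%N.
Proof.
case: a => x u neq_sw.
have ordSD (t : 'I_T.+1) : ordS u + t = ordS (u + t).
  by apply: val_inj; rewrite /= modnDml addSn -[(_ %% _).+1]addn1 modnDml addn1.
under eq_bigr do rewrite /intercepts !oscillationE ordSD.
(* Averaging over the phase makes the attack time [u] irrelevant. *)
rewrite (reindex_inj (addrI (- u))).
under eq_bigr do rewrite addrA subrr add0r.
case: (eqVneq x s) => [->|neq_xs].
  rewrite (negbTE neq_sw) addn0 mul1n -[RHS]muln1 -[in RHS](card_ord T.+1).
  rewrite -sum_nat_const; apply: eq_bigr => z _.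
  have := even_or_even_ordS z.
  by do 2 case: (odd _); rewrite ?eqxx ?orbT.
case: (eqVneq x w) => [->|neq_xw].
  rewrite add0n mul1n -sum_odd_or_odd_ordS; apply: eq_bigr => z _.
  by do 2 case: (odd _); rewrite ?eqxx ?orbT ?(negbTE neq_sw).
rewrite big1 // => z _.
by do 2 case: (odd _); rewrite !(eq_sym _ x) ?(negbTE neq_xs) ?(negbTE neq_xw).
Qed.

(** * Even and odd nodes of the path *)

Lemma even_node_subproof {m : nat} {r : bool} (y : 'I_(m + r)) :
  (y.*2 < m.*2 + r)%N.
Proof. by case: r y => y; have := ltn_ord y; lia. Qed.

(** The bit [r] is the parity of the number of nodes; numbering starts at 0, so an odd path has one
    extra even node. *)
Definition even_node {m : nat} {r : bool} (y : 'I_(m + r)) : 'I_(m.*2 + r) :=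
  Ordinal (even_node_subproof y).

Lemma odd_node_subproof {m : nat} {r : bool} (e : 'I_m) :
  (e.*2.+1 < m.*2 + r)%N.
Proof. by have := ltn_ord e; lia. Qed.

Definition odd_node {m : nat} {r : bool} (e : 'I_m) : 'I_(m.*2 + r) :=
  Ordinal (odd_node_subproof e).

Lemma even_node_inj {m : nat} {r : bool} : injective (@even_node m r).
Proof. by move=> y y' /(congr1 val) /= /double_inj /val_inj. Qed.

Lemma odd_node_inj {m : nat} {r : bool} : injective (@odd_node m r).
Proof. by move=> y y' /(congr1 val) /= [] /double_inj /val_inj. Qed.

Lemma even_neq_odd_node {m : nat} {r : bool} (y : 'I_(m + r)) (e : 'I_m) :
  (even_node y == odd_node e) = false.
Proof.
by apply/negP => /eqP/(congr1 (fun i => odd (val i))); rewrite /= !odd_double.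
Qed.

Variant line_node_spec {m : nat} {r : bool} : 'I_(m.*2 + r) -> Type :=
| EvenNode y : line_node_spec (even_node y)
| OddNode e : line_node_spec (odd_node e).

Lemma line_nodeP {m : nat} {r : bool} (x : 'I_(m.*2 + r)) : line_node_spec x.
Proof.
have xE := odd_double_half x; have lt_x := ltn_ord x.
case odd_x: (odd x) xE => xE.
  have lt_e : (x./2 < m)%N by case: r x {xE} lt_x odd_x => x; lia.
  suff -> : x = odd_node (Ordinal lt_e) by constructor.
  by apply: val_inj; rewrite /= -[LHS]xE.
have lt_y : (x./2 < m + r)%N by case: r x {xE} lt_x odd_x => x; lia.
suff -> : x = even_node (Ordinal lt_y) by constructor.
by apply: val_inj; rewrite /= -[LHS]xE.
Qed.

Lemma line_adj_sym {n : nat} (i j : 'I_n) : line_adj i j = line_adj j i.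
Proof. by rewrite /line_adj orbC. Qed.

(** * The Patroller's random matching *)

Lemma sum_quadruple {R : realType} {A B C D : finType} (f : A * B * C * D -> R) :
  \sum_i f i = \sum_a \sum_b \sum_c \sum_d f (a, b, c, d).
Proof. by rewrite !pair_bigA; apply: eq_bigr => -[[[a b] c] d]. Qed.

(* A sample [(j, s, b, t)] consists of the matching
   [{even_node (g j e), odd_node e}], the cyclic shift [s] of its edges, the end
   [b] of the edge which is always protected, and the phase [t]. *)
Section RandomMatching.
Context {R : realType} {T m : nat} {r : bool} {J : finType}.
Context (g : J -> 'I_m.+1 -> 'I_(m.+1 + r)) (p v : R).
Hypothesis J_gt0 : (0 < #|J|)%N.
Hypothesis p01 : 0 <= p <= 1.
Hypothesis g_inj : forall j, injective (g j).
Hypothesis g_adj : forall j e, (g j e == e :> nat) || (g j e == e.+1 :> nat).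
Hypothesis g_unif : forall y,
  ((\sum_j \sum_e (g j e == y)) * (m.+1 + r) = #|J| * m.+1)%N.

Notation weight := (fun i : J * 'I_m.+1 * bool * 'I_T.+1 =>
  (if i.1.2 then p else 1 - p) / (#|J| * m.+1 * T.+1)%:R).

Lemma matched_adj j e : line_adj (even_node (g j e)) (odd_node e).
Proof.
by rewrite /line_adj /=; case/orP: (g_adj j e) => /eqP ->; rewrite eqxx ?orbT.
Qed.

Lemma matched_adj_sym j e : line_adj (odd_node e) (even_node (g j e)).
Proof. by rewrite line_adj_sym matched_adj. Qed.

(** For a fixed sample the edges [s + e] are distinct, while a uniform [s] places each single patrol
    on a uniform edge. *)
Definition matching_patrol (i : J * 'I_m.+1 * bool * 'I_T.+1) (e : 'I_m.+1) :
    patrol T.+1 (@line_adj (m.+1.*2 + r)) :=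
  let: (j, s, b, t) := i in
  if b then oscillation (matched_adj j (s + e)) (matched_adj_sym j (s + e)) t
  else oscillation (matched_adj_sym j (s + e)) (matched_adj j (s + e)) t.

Lemma weight_ge0 i : 0 <= weight i.
Proof.
case/andP: p01 => p0 p1; rewrite divr_ge0 //.
by case: ifP; rewrite ?subr_ge0.
Qed.

Lemma sum_weight : \sum_i weight i = 1.
Proof.
rewrite sum_quadruple /=.
have D0 : (#|J| * m.+1 * T.+1)%:R != 0 :> R.
  by rewrite pnatr_eq0 !muln_eq0 eqn0Ngt J_gt0.
under eq_bigr do under eq_bigr do
  rewrite big_bool /= !sumr_const -mulrnDl -mulrDl addrC subrK card_ord.
rewrite !sumr_const card_ord -!mulrnA div1r -[LHS]mulr_natr.
by rewrite [(T.+1 * _)%N]mulnC [(_ * #|_|)%N]mulnC mulVf.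
Qed.

Lemma matching_patrol_disjoint i a e e' :
  intercepts (matching_patrol i e) a -> intercepts (matching_patrol i e') a ->
  e = e'.
Proof.
case: i a => [[[j s] b] t] [x u] /=.
have node z : intercepts (matching_patrol (j, s, b, t) z) (x, u) ->
    (x == even_node (g j (s + z))) || (x == odd_node (s + z)).
  by rewrite /=; case: b => iu; have := oscillation_node _ _ _ _ iu; rewrite /= 1?orbC.
move=> /node + /node; case: (line_nodeP x) => [y|z].
  rewrite !even_neq_odd_node !orbF !(inj_eq even_node_inj).
  by move=> /eqP -> /eqP /g_inj /addrI.
rewrite !(eq_sym _ (even_node _)) !even_neq_odd_node /= !(inj_eq odd_node_inj).
by move=> /eqP -> /eqP /addrI.
Qed.

Lemma matching_patrol_coverage e a :
  \sum_i weight i * patrolling_payoff R (matching_patrol i e) a =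
  (\sum_j \sum_s (a.1 == even_node (g j s)))%:R
    * (T.+1%:R - (1 - p) * (odd T.+1)%:R) / (#|J| * m.+1 * T.+1)%:R +
  (\sum_(j : J) \sum_s (a.1 == odd_node s))%:R
    * (T.+1%:R - p * (odd T.+1)%:R) / (#|J| * m.+1 * T.+1)%:R.
Proof.
rewrite sum_quadruple !natr_sum !mulr_suml -big_split; apply: eq_bigr => j _ /=.
(* Shifting [s] by [e] shows that all patrols have the same coverage. *)
rewrite !natr_sum !mulr_suml -big_split /= [RHS](reindex_inj (addIr e)).
apply: eq_bigr => s _; rewrite big_bool /= /patrolling_payoff -!mulr_sumr.
rewrite -!natr_sum !oscillation_interceptions.
- rewrite !natrD !natrM natrB; last by case: (odd _).
  by ring.
- by rewrite eq_sym even_neq_odd_node.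
- by rewrite even_neq_odd_node.
Qed.

Hypothesis v_even :
  v * ((m.+1 + r) * T.+1)%:R <= T.+1%:R - (1 - p) * (odd T.+1)%:R.
Hypothesis v_odd : v * (m.+1 * T.+1)%:R <= T.+1%:R - p * (odd T.+1)%:R.

(** Among the pairs of a matching and an edge, a given even node lies on a fraction [1 / (m.+1 + r)]
    by [g_unif], a given odd node on a fraction [1 / m.+1]; hence the factors in [v_even] and
    [v_odd]. *)
Lemma matching_patrol_guarantee e a :
  v <= \sum_i weight i * patrolling_payoff R (matching_patrol i e) a.
Proof.
have D0 : 0 < (#|J| * m.+1 * T.+1)%:R :> R by rewrite ltr0n !muln_gt0 J_gt0.
rewrite matching_patrol_coverage; case: a => x u /=; case: (line_nodeP x) => y.
  have -> : (\sum_(j : J) \sum_s (even_node y == odd_node s) = 0)%N.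
    by do 2 (rewrite big1 // => ? _); rewrite even_neq_odd_node.
  rewrite !mul0r addr0 ler_pdivlMr //.
  under eq_bigr do under eq_bigr do rewrite (inj_eq even_node_inj) eq_sym.
  apply: le_trans (ler_wpM2l (ler0n _ _) v_even).
  by rewrite mulrCA -natrM mulnA g_unif.
have -> : (\sum_j \sum_s (odd_node y == even_node (g j s)) = 0)%N.
  by do 2 (rewrite big1 // => ? _); rewrite eq_sym even_neq_odd_node.
have -> : (\sum_(j : J) \sum_s (odd_node y == odd_node s :> 'I_(m.+1.*2 + r)) = #|J|)%N.
  rewrite (eq_bigr (fun=> 1%N)) ?sum_nat_const ?muln1 // => j _.
  rewrite (bigD1 y) //= eqxx big1 // => s /negbTE neq_sy.
  by rewrite (inj_eq odd_node_inj) eq_sym neq_sy.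
rewrite !mul0r add0r ler_pdivlMr //.
apply: le_trans (ler_wpM2l (ler0n _ _) v_odd).
by rewrite mulrCA -natrM mulnA.
Qed.

Lemma line_value {I' : finType} (nu : I' -> R)
    (G : I' -> attack T.+1 'I_(m.+1.*2 + r)) (k : nat) :
  (forall i, 0 <= nu i) -> \sum_i nu i = 1 ->
  (forall w : patrol T.+1 (@line_adj (m.+1.*2 + r)),
    \sum_i nu i * patrolling_payoff R w (G i) <= v) ->
  (1 <= k <= m.+1)%N ->
  is_value (@patrolling_payoff R T.+1 _ (@line_adj (m.+1.*2 + r))) v /\
  is_value (@multi_patrolling_payoff R T.+1 _ (@line_adj (m.+1.*2 + r)) k)
    (k%:R * v).
Proof.
move=> nu0 nu1 up.
apply: (disjoint_patrols_value weight nu matching_patrol G) => //.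
- exact: weight_ge0.
- exact: sum_weight.
- exact: matching_patrol_disjoint.
- exact: matching_patrol_guarantee.
Qed.

End RandomMatching.

(** * Upper bounds from the Attacker *)

Lemma line_adj_odd {n : nat} (i j : 'I_n) : line_adj i j -> odd j = ~~ odd i.
Proof. by case/orP => /eqP <- //=; rewrite negbK. Qed.

(* The parity of the node flips exactly at the moves of a closed walk. *)
Lemma odd_patrol_moves {T n : nat} (w : patrol T (@line_adj n)) :
  odd (\sum_t (val w t != val w (ordS t))) = false.
Proof.
have ordS_inj : injective (@ordS T) by apply: can_inj; exact: ordSK.
have oddD := big_morph odd oddD (erefl (odd 0)).
suff : odd (\sum_t (val w t != val w (ordS t))) =
    odd (\sum_t val w t + \sum_t val w (ordS t)).
  by move=> ->; rewrite [X in (X + _)%N](reindex_inj ordS_inj) addnn odd_double.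
rewrite -big_split !oddD; apply: eq_bigr => t _ /=.
rewrite ssrnat.oddD; case/orP: (forallP (valP w) t) => [/eqP <-|adj_w].
  by rewrite eqxx addbb.
rewrite (line_adj_odd _ _ adj_w) addbN addbb; case: eqP => // w_eq.
by have := line_adj_odd _ _ adj_w; rewrite w_eq; case: (odd _).
Qed.

(** For each starting time a patrol meets one node if it rests and two if it moves. The number of
    moves is at most [T] and even, hence at most [T - odd T]. *)
Lemma sum_intercepts_le {T n : nat} (w : patrol T (@line_adj n)) :
  (\sum_a intercepts w a <= T.*2 - odd T)%N.
Proof.
have -> : (\sum_a intercepts w a =
    \sum_t \sum_i ((val w t == i) || (val w (ordS t) == i)))%N.
  by rewrite exchange_big pair_bigA.
have -> : (\sum_t \sum_i ((val w t == i) || (val w (ordS t) == i)) =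
    T + \sum_t (val w t != val w (ordS t)))%N.
  rewrite -[T in (T + _)%N]card_ord -sum1_card -big_split.
  apply: eq_bigr => t _ /=; set x := val w t; set y := val w (ordS t).
  rewrite (bigD1 x) //= eqxx; congr (_ + _)%N.
  case: (eqVneq x y) => [<-|neq_xy].
    by rewrite big1 // => i; rewrite eq_sym => /negbTE ->.
  rewrite (bigD1 y) 1?eq_sym //= eqxx orbT big1 // => i /andP[].
  by rewrite !(eq_sym i) => /negbTE -> /negbTE ->.
have le_T : (\sum_t (val w t != val w (ordS t)) <= T)%N.
  by rewrite -[leqRHS]card_ord -sum1_card; apply: leq_sum => t _; case: eqP.
have := odd_patrol_moves w; lia.
Qed.

Lemma uniform_attack_bound {R : realType} {T n : nat}
    (w : patrol T (@line_adj n)) : (0 < n * T)%N ->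
  \sum_(a : attack T 'I_n) (n * T)%:R^-1 * patrolling_payoff R w a <=
  (T.*2 - odd T)%:R / (n * T)%:R.
Proof.
move=> nT0; rewrite -mulr_sumr mulrC ler_wpM2r ?invr_ge0 //.
by rewrite -natr_sum ler_nat sum_intercepts_le.
Qed.

(** A move changes the parity of the node, so a patrol meets at most one even node during a given
    attack interval. *)
Lemma synchronous_attack_bound {R : realType} {T m : nat} {r : bool}
    (w : patrol T (@line_adj (m.*2 + r))) (t : 'I_T) :
  \sum_(y < m + r) (m + r)%:R^-1 * patrolling_payoff R w (even_node y, t) <=
  (m + r)%:R^-1.
Proof.
rewrite -mulr_sumr ler_piMr ?invr_ge0 // -natr_sum lern1.
have uniq_y y y' : intercepts w (even_node y, t) ->
    intercepts w (even_node y', t) -> y = y'.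
  have := forallP (valP w) t.
  rewrite /intercepts /= => /orP[/eqP <-|/line_adj_odd odd_w].
    by rewrite !orbb => /eqP -> /eqP /even_node_inj.
  move=> /orP[]/eqP w1 /orP[]/eqP w2; move: odd_w;
    rewrite ?w1 ?w2 /= ?odd_double // => _.
  - by apply: even_node_inj; rewrite -w1.
  - by apply: even_node_inj; rewrite -w1.
case: (pickP (fun y => intercepts w (even_node y, t))) => [y iy|no_y].
  rewrite (bigD1 y) //= iy big1 // => y' neq_y'.
  case iy': (intercepts _ _) => //.
  by rewrite (uniq_y _ _ iy' iy) eqxx in neq_y'.
by rewrite big1 // => y _; rewrite no_y.
Qed.

(** * Values for even and odd [n] *)

Lemma uniform_distribution {R : realType} (I : finType) (c : nat) :
  #|I| = c -> (0 < c)%N -> \sum_(i : I) c%:R^-1 = 1 :> R.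
Proof.
by move=> cI c0; rewrite sumr_const cI -[LHS]mulr_natl mulfV // pnatr_eq0 -lt0n.
Qed.

Lemma sum_lift {m : nat} (y : 'I_m.+1) :
  (\sum_j \sum_e (lift j e == y) = m)%N.
Proof.
rewrite (bigD1 y) //= big1 => [|e _]; last by rewrite eq_sym (negbTE (neq_lift _ _)).
rewrite add0n (eq_bigr (fun=> 1%N)) => [|j /unlift_some [e -> _]].
  by rewrite sum1_card cardC1 card_ord.
rewrite (bigD1 e) //= eqxx big1 // => e' /negbTE neq_e.
by rewrite (inj_eq lift_inj) neq_e.
Qed.

(** The two inequalities are [v_even] and [v_odd] for the bound of [uniform_attack_bound], cleared
    of denominators. *)
Lemma uniform_attack_value {R : realType} {T m : nat} {r : bool} {J : finType}
    (g : J -> 'I_m.+1 -> 'I_(m.+1 + r)) (p : R) (k : nat) :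
  (0 < #|J|)%N -> 0 <= p <= 1 -> (forall j, injective (g j)) ->
  (forall j e, (g j e == e :> nat) || (g j e == e.+1 :> nat)) ->
  (forall y, (\sum_j \sum_e (g j e == y)) * (m.+1 + r) = #|J| * m.+1)%N ->
  (T.+1.*2 - odd T.+1)%:R * (m.+1 + r)%:R <=
    (m.+1.*2 + r)%:R * (T.+1%:R - (1 - p) * (odd T.+1)%:R) ->
  (T.+1.*2 - odd T.+1)%:R * m.+1%:R <=
    (m.+1.*2 + r)%:R * (T.+1%:R - p * (odd T.+1)%:R) ->
  (1 <= k <= m.+1)%N ->
  exists v : R,
    is_value (@patrolling_payoff R T.+1 _ (@line_adj (m.+1.*2 + r))) v /\
    is_value (@multi_patrolling_payoff R T.+1 _ (@line_adj (m.+1.*2 + r)) k)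
      (k%:R * v).
Proof.
move=> J0 p01 g_inj g_adj g_unif v_even v_odd km; set n := (m.+1.*2 + r)%N.
have t0 : T.+1%:R != 0 :> R by rewrite pnatr_eq0.
have n0 : 0 < n%:R :> R by rewrite ltr0n.
pose v : R := (T.+1.*2 - odd T.+1)%:R / (n * T.+1)%:R.
have vE c x : (T.+1.*2 - odd T.+1)%:R * c%:R <= n%:R * x ->
    v * (c * T.+1)%:R <= x.
  rewrite -ler_pdivrMl // => h; apply: le_trans h.
  by rewrite le_eqVlt; apply/orP; left; apply/eqP; rewrite /v !natrM; field;
    rewrite lt0r_neq0 ?nat1r.
exists v; apply: (line_value g p v _ _ _ _ _ _ _ (fun=> (n * T.+1)%:R^-1) id k);
  rewrite ?vE //.
- by move=> _; rewrite invr_ge0.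
- by apply: uniform_distribution; rewrite // card_prod !card_ord.
- by move=> w; apply: uniform_attack_bound.
Qed.

Lemma even_line_value {R : realType} {T m k : nat} : (1 <= k <= m.+1)%N ->
  exists v : R,
    is_value (@patrolling_payoff R T.+1 _ (@line_adj (m.+1.*2 + false))) v /\
    is_value (@multi_patrolling_payoff R T.+1 _ (@line_adj (m.+1.*2 + false)) k)
      (k%:R * v).
Proof.
(* There is a single perfect matching, so [J] is [unit]; with [p = 1/2] both inequalities are
   equalities. *)
apply: (@uniform_attack_value R T m false unit
  (fun _ => cast_ord (esym (addn0 m.+1))) 2^-1 k).
- by rewrite card_unit.
- by apply/andP; split; lra.
- by move=> _; apply: cast_ord_inj.
- by move=> _ e /=; rewrite eqxx.
- move=> y; rewrite (eq_bigr (fun=> 1%N)) => [|j _].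
    by rewrite sum1_card card_unit /= addn0.
  rewrite (bigD1 (cast_ord (addn0 m.+1) y)) //= cast_ordK eqxx big1 // => e.
  move=> /negbTE neq_e.
  by rewrite -(inj_eq (@cast_ord_inj _ _ (addn0 m.+1))) cast_ordKV neq_e.
- rewrite !addn0 natrB; last by case: odd.
  by rewrite -!mul2n !natrM; lra.
- rewrite !addn0 natrB; last by case: odd.
  by rewrite -!mul2n !natrM; lra.
Qed.

Lemma lift_adj {m : nat} (j : 'I_m.+1) (e : 'I_m) :
  (lift j e == e :> nat) || (lift j e == e.+1 :> nat).
Proof. by rewrite /= /bump; case: leqP; rewrite ?eqxx ?orbT. Qed.

Lemma odd_line_value {R : realType} {T m k : nat} : (1 <= k <= m.+1)%N ->
  exists v : R,
    is_value (@patrolling_payoff R T.+1 _ (@line_adj (m.+1.*2 + true))) v /\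
    is_value (@multi_patrolling_payoff R T.+1 _ (@line_adj (m.+1.*2 + true)) k)
      (k%:R * v).
Proof.
move=> km.
(* [lift j] skips the unmatched even node [j]: odd nodes before it are matched to the left, those
   after it to the right. *)
pose g (j : 'I_m.+2) (e : 'I_m.+1) : 'I_(m.+1 + true) :=
  cast_ord (esym (addn1 m.+1)) (lift j e).
have g_inj j : injective (g j) by move=> e e' /cast_ord_inj /lift_inj.
have g_adj j e : (g j e == e :> nat) || (g j e == e.+1 :> nat) by apply: lift_adj.
have g_unif y :
    ((\sum_j \sum_e (g j e == y)) * (m.+1 + true) = #|'I_m.+2| * m.+1)%N.
  suff -> : (\sum_j \sum_e (g j e == y) = m.+1)%N.
    by rewrite card_ord addn1 mulnC.
  rewrite -[RHS](sum_lift (cast_ord (addn1 m.+1) y)).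
  apply: eq_bigr => j _; apply: eq_bigr => e _.
  by rewrite -(inj_eq (@cast_ord_inj _ _ (addn1 m.+1))) cast_ordKV.
have J0 : (0 < #|'I_m.+2|)%N by rewrite card_ord.
case: (boolP (~~ odd T.+1 || (m.+1 < T.+1)%N)) => [long|].
  exists (m.+1 + true)%:R^-1.
  (* With [p = 1] the condition at even nodes is an equality, and the one at odd nodes reads
     [m.+2 * odd T.+1 <= T.+1], which is [long]. *)
  apply: (line_value g 1 _ _ _ _ _ _ _ _
    (fun=> (m.+1 + true)%:R^-1) (fun y => (even_node y, ord0)) k) => //.
  - by rewrite ler01 lexx.
  - by rewrite subrr mul0r subr0 natrM mulKf // pnatr_eq0.
  - rewrite mul1r -ler_pdivlMl ?invr_gt0 // invrK.
    rewrite -natrB; last by case: odd.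
    rewrite -natrM ler_nat; case/orP: long => [/negbTE -> | long]; first by lia.
    by case: odd; nia.
  - by move=> _; rewrite invr_ge0.
  - by apply: uniform_distribution; rewrite ?card_ord.
  - by move=> w; apply: synchronous_attack_bound.
rewrite negb_or negbK -leqNgt => /andP[odd_T le_Tm].
(* This [p] turns both inequalities into equalities; [p <= 1] follows from [le_Tm]. *)
apply: (uniform_attack_value g
  ((T.+1 + m.+1)%:R / (m.+1.*2 + true)%:R) k) => //.
- rewrite divr_ge0 //= ler_pdivrMr ?ltr0n // mul1r ler_nat; lia.
- rewrite odd_T natrB // -!mul2n !natrD !natrM /=; have m_ge0 := ler0n R m.
  rewrite le_eqVlt; apply/orP; left; apply/eqP; field.
  by rewrite lt0r_neq0 //; lra.
- rewrite odd_T natrB // -!mul2n !natrD !natrM /=; have m_ge0 := ler0n R m.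
  rewrite le_eqVlt; apply/orP; left; apply/eqP; field.
  by rewrite lt0r_neq0 //; lra.
Qed.

Theorem theorem13 (R : realType) (T n k : nat)
    (hT : (2 <= T)%N) (hn : (2 <= n)%N) (hk : (1 <= k)%N)
    (hkn : (2 * k <= n)%N) :
  exists V Vk : R,
    [/\ is_value (@patrolling_payoff R T 'I_n (@line_adj n)) V,
        is_value (@multi_patrolling_payoff R T 'I_n (@line_adj n) k) Vk
      & Vk = k%:R * V].
Proof.
case: T hT => // T _.
(* Here [m.+1] is [n./2], positive as [n >= 2]; the successor form gives ['I_m.+1] its cyclic
   addition. *)
have [m nE] : exists m, n = (m.+1.*2 + odd n)%N.
  by exists n./2.-1; have := odd_double_half n; lia.
have km : (1 <= k <= m.+1)%N by lia.
rewrite nE; case: (odd n).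
  by have [v [v1 vk]] := @odd_line_value R T m k km; exists v, (k%:R * v).
by have [v [v1 vk]] := @even_line_value R T m k km; exists v, (k%:R * v).
Qed.
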